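(* The rules Cut and Contraction are admissible in $\mathsf{G4iSL}_\Box$. That is: if $\Gamma_1\Rightarrow\varphi$ and $\varphi,\Gamma_2\Rightarrow\Delta$ are derivable in $\mathsf{G4iSL}_\Box$, then so is $\Gamma_1,\Gamma_2\Rightarrow\Delta$; and if $\Gamma,\varphi,\varphi\Rightarrow\Delta$ is derivable in $\mathsf{G4iSL}_\Box$, then so is $\Gamma,\varphi\Rightarrow\Delta$.
   Context: Formulas are built from the constant $\bot$, atoms (propositional variables) $p,q,r,\dots$, binary connectives $\wedge,\vee,\to$ and the unary modal operator $\Box$ (there is no $\Diamond$); $\neg\varphi$ abbreviates $\varphi\to\bot$; $\bot$ is not an atom. A sequent is an expression $\Gamma\Rightarrow\Delta$ with $\Gamma,\Delta$ finite multisets of formulas, $\Delta$ containing at most one formula. $\Gamma,\Pi$ denotes multiset union. $\Box\Gamma$ is the multiset $\{\Box\varphi\mid\varphi\in\Gamma\}$ and $\boxdot\Gamma=\Gamma\cup\Box\Gamma$ (multiset union). A formula is boxed if it has the form $\Box\psi$. The calculus $\mathsf{G4iSL}_\Box$ has the following axioms and rules (''from premises infer conclusion''): At: $\Gamma,p\Rightarrow p$ ($p$ an atom). $L\bot$: $\Gamma,\bot\Rightarrow\Delta$. $R\wedge$: from $\Gamma\Rightarrow\varphi$ and $\Gamma\Rightarrow\psi$ infer $\Gamma\Rightarrow\varphi\wedge\psi$. $L\wedge$: from $\Gamma,\varphi,\psi\Rightarrow\Delta$ infer $\Gamma,\varphi\wedge\psi\Rightarrow\Delta$. $R\vee$: from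 $\Gamma\Rightarrow\varphi_i$ ($i=0$ or $1$) infer $\Gamma\Rightarrow\varphi_0\vee\varphi_1$. $L\vee$: from $\Gamma,\varphi\Rightarrow\Delta$ and $\Gamma,\psi\Rightarrow\Delta$ infer $\Gamma,\varphi\vee\psi\Rightarrow\Delta$. $R{\to}$: from $\Gamma,\varphi\Rightarrow\psi$ infer $\Gamma\Rightarrow\varphi\to\psi$. $Lp{\to}$: from $\Gamma,p,\varphi\Rightarrow\Delta$ infer $\Gamma,p,p\to\varphi\Rightarrow\Delta$ ($p$ an atom). $L{\wedge}{\to}$: from $\Gamma,\varphi\to(\psi\to\gamma)\Rightarrow\Delta$ infer $\Gamma,\varphi\wedge\psi\to\gamma\Rightarrow\Delta$. $L{\vee}{\to}$: from $\Gamma,\varphi\to\gamma,\psi\to\gamma\Rightarrow\Delta$ infer $\Gamma,\varphi\vee\psi\to\gamma\Rightarrow\Delta$. $L{\to}{\to}$: from $\Gamma,\psi\to\gamma\Rightarrow\varphi\to\psi$ and $\Gamma,\gamma\Rightarrow\Delta$ infer $\Gamma,(\varphi\to\psi)\to\gamma\Rightarrow\Delta$. $\to_{\rm SL}$: from $\Pi,\boxdot\Gamma,\Box\varphi,\Box\varphi\to\psi\Rightarrow\varphi$ and $\Pi,\Box\Gamma,\psi\Rightarrow\Delta$ infer $\Pi,\Box\Gamma,\Box\varphi\to\psi\Rightarrow\Delta$, where $\Pi$ contains no boxed formulas. $\mathcal R^4_{\rm SL}$: from $\Pi,\boxdot\Gamma,\Box\varphi\Rightarrow\varphi$ infer $\Pi,\Box\Gamma\Rightarrow\Box\varphi$,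 where $\Pi$ contains no boxed formulas. *)

(* Defs.v *)
From HB Require Import structures.
From mathcomp Require Import all_boot.
From mathcomp Require Import finmap multiset.

Set Implicit Arguments.
Unset Strict Implicit.
Unset Printing Implicit Defensive.

Local Open Scope mset_scope.

Inductive formula : Type :=
| Bot
| Atom of nat
| And of formula & formula
| Or of formula & formula
| Imp of formula & formula
| Box of formula.

(* Multisets need a choiceType of elements; it is obtained from an encoding
   of formulas as trees. *)
Fixpoint tree_of_formula (phi : formula) : GenTree.tree nat :=
  match phi with
  | Bot => GenTree.Node 0 [::]
  | Atom p => GenTree.Leaf p
  | And a b => GenTree.Node 1 [:: tree_of_formula a; tree_of_formula b]
  | Or a b => GenTree.Node 2 [:: tree_of_formula a; tree_of_formula b]
  | Imp a b => GenTree.Node 3 [:: tree_of_formula a; tree_of_formula b]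
  | Box a => GenTree.Node 4 [:: tree_of_formula a]
  end.

Fixpoint formula_of_tree (t : GenTree.tree nat) : formula :=
  match t with
  | GenTree.Leaf p => Atom p
  | GenTree.Node 1 [:: a; b] => And (formula_of_tree a) (formula_of_tree b)
  | GenTree.Node 2 [:: a; b] => Or (formula_of_tree a) (formula_of_tree b)
  | GenTree.Node 3 [:: a; b] => Imp (formula_of_tree a) (formula_of_tree b)
  | GenTree.Node 4 [:: a] => Box (formula_of_tree a)
  | GenTree.Node _ _ => Bot
  end.

Lemma tree_of_formulaK : cancel tree_of_formula formula_of_tree.
Proof. by elim=> //= [a -> b ->|a -> b ->|a -> b ->|a ->]. Qed.

HB.instance Definition _ := Countable.copy formula (can_type tree_of_formulaK).

Definition is_boxed (phi : formula) : bool :=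
  if phi is Box _ then true else false.

Definition box_free (Pi : {mset formula}) : Prop :=
  forall phi, phi \in Pi -> ~~ is_boxed phi.

Definition boxes (Gamma : {mset formula}) : {mset formula} :=
  seq_mset [seq Box phi | phi <- Gamma].

Definition boxdot (Gamma : {mset formula}) : {mset formula} :=
  Gamma `+` boxes Gamma.

(* [G4iSL Gamma Delta] is derivability of the sequent Gamma => Delta; the
   succedent, a multiset with at most one element, is an [option]. *)
Inductive G4iSL : {mset formula} -> option formula -> Prop :=
| At Gamma p :
    G4iSL (Gamma `+` [mset Atom p]) (Some (Atom p))
| LBot Gamma Delta :
    G4iSL (Gamma `+` [mset Bot]) Delta
| RAnd Gamma phi psi :
    G4iSL Gamma (Some phi) ->
    G4iSL Gamma (Some psi) ->
    G4iSL Gamma (Some (And phi psi))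
| LAnd Gamma phi psi Delta :
    G4iSL (Gamma `+` [mset phi] `+` [mset psi]) Delta ->
    G4iSL (Gamma `+` [mset And phi psi]) Delta
| ROr0 Gamma phi0 phi1 :
    G4iSL Gamma (Some phi0) ->
    G4iSL Gamma (Some (Or phi0 phi1))
| ROr1 Gamma phi0 phi1 :
    G4iSL Gamma (Some phi1) ->
    G4iSL Gamma (Some (Or phi0 phi1))
| LOr Gamma phi psi Delta :
    G4iSL (Gamma `+` [mset phi]) Delta ->
    G4iSL (Gamma `+` [mset psi]) Delta ->
    G4iSL (Gamma `+` [mset Or phi psi]) Delta
| RImp Gamma phi psi :
    G4iSL (Gamma `+` [mset phi]) (Some psi) ->
    G4iSL Gamma (Some (Imp phi psi))
| LAtomImp Gamma p phi Delta :
    G4iSL (Gamma `+` [mset Atom p] `+` [mset phi]) Delta ->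
    G4iSL (Gamma `+` [mset Atom p] `+` [mset Imp (Atom p) phi]) Delta
| LAndImp Gamma phi psi gamma Delta :
    G4iSL (Gamma `+` [mset Imp phi (Imp psi gamma)]) Delta ->
    G4iSL (Gamma `+` [mset Imp (And phi psi) gamma]) Delta
| LOrImp Gamma phi psi gamma Delta :
    G4iSL (Gamma `+` [mset Imp phi gamma] `+` [mset Imp psi gamma]) Delta ->
    G4iSL (Gamma `+` [mset Imp (Or phi psi) gamma]) Delta
| LImpImp Gamma phi psi gamma Delta :
    G4iSL (Gamma `+` [mset Imp psi gamma]) (Some (Imp phi psi)) ->
    G4iSL (Gamma `+` [mset gamma]) Delta ->
    G4iSL (Gamma `+` [mset Imp (Imp phi psi) gamma]) Delta
| ImpSL Pi Gamma phi psi Delta :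
    box_free Pi ->
    G4iSL (Pi `+` boxdot Gamma `+` [mset Box phi] `+` [mset Imp (Box phi) psi])
          (Some phi) ->
    G4iSL (Pi `+` boxes Gamma `+` [mset psi]) Delta ->
    G4iSL (Pi `+` boxes Gamma `+` [mset Imp (Box phi) psi]) Delta
| R4SL Pi Gamma phi :
    box_free Pi ->
    G4iSL (Pi `+` boxdot Gamma `+` [mset Box phi]) (Some phi) ->
    G4iSL (Pi `+` boxes Gamma) (Some (Box phi)).

(* Main.v *)
(* Cut and contraction are sound for a Kripke semantics, so it suffices that the
   calculus is sound and complete for it.  The models are finite trees with
   intuitionistic and modal edges: [le] is reachability, and the modal relation
   [below] is reachability through at least one modal edge, so that it is
   transitive, contained in [le], and conversely well-founded.

   For completeness, backward proof search either derives a sequent or produces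
   a countermodel.  Invertible rules transfer countermodels from premises to the
   conclusion; for an irreducible sequent, the countermodels of the underivable
   premises of the remaining rules become the children of a new root.  Search
   terminates because the modal rules put a new boxed subformula in the
   antecedent, while every other premise keeps the boxed antecedents and
   decreases the sum of 4 ^ weight.  If [Box phi] is already in the antecedent, the modal premise
   proving [phi] is an instance of the identity and no search is needed. *)
Require Import Defs.
From Stdlib Require Import Setoid.
From mathcomp Require Import all_boot.
From mathcomp Require Import finmap multiset.
From mathcomp Require Import zify.

Set Implicit Arguments.
Unset Strict Implicit.
Unset Printing Implicit Defensive.

Local Open Scope mset_scope.

(** * Multisets and their boxed part *)

Ltac mset_ac := apply/msetP => ?; rewrite !msetE2; lia.

Lemma enum_msetD (K : choiceType) (A B : {mset K}) : perm_eq (A `+` B) (A ++ B).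
Proof. by apply/allP => x _ /=; rewrite count_cat !count_mem_mset msetE2. Qed.

Lemma mset_split (K : choiceType) (A : {mset K}) (x : K) :
  x \in A -> exists A', A = A' `+` [mset x].
Proof. by move=> xA; exists (A `\ x); rewrite msetDC msetB1K. Qed.

Lemma boxes1D (G : {mset formula}) (phi : formula) :
  boxes ([mset phi] `+` G) = [mset Box phi] `+` boxes G.
Proof.
rewrite /boxes -mset_cons; apply/eq_seq_msetP.
by rewrite -map_cons perm_map // (permPl (enum_msetD _ _)) enum_msetn.
Qed.

Lemma mem_boxes (G : {mset formula}) (phi : formula) :
  (phi \in boxes G) = if phi is Box psi then psi \in G else false.
Proof.
rewrite (perm_mem (perm_eq_seq_mset _)).
apply/mapP/idP => [[psi psiG ->] //|]; case: phi => // psi psiG.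
by exists psi.
Qed.

(** The modal rules speak of a box-free part and a boxed part; this brings an arbitrary antecedent
    into that shape. *)
Lemma box_decomposition (A : {mset formula}) :
  exists Pi G, box_free Pi /\ A = Pi `+` boxes G.
Proof.
suff H s : exists Pi G, box_free Pi /\ seq_mset s = Pi `+` boxes G.
  by rewrite -(seq_mset_id A).
elim: s => [|phi s [Pi [G [PiF E]]]].
  exists mset0, mset0; split; first by move=> phi; rewrite in_mset0.
  by rewrite mset0D /boxes enum_mset0.
rewrite mset_cons E; have [bphi|nphi] := boolP (is_boxed phi).
  case: phi bphi => // phi _; exists Pi, ([mset phi] `+` G); split=> //.
  by rewrite boxes1D msetDCA.
exists ([mset phi] `+` Pi), G; split; last by rewrite msetDA.
by move=> psi; rewrite in_msetD in_mset1 => /orP[/eqP-> //|/PiF].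
Qed.

Lemma box_decomposition_mem (A : {mset formula}) (phi : formula) :
  Box phi \in A -> exists Pi G, box_free Pi /\ A = Pi `+` boxes ([mset phi] `+` G).
Proof.
move=> /mset_split[A' ->]; have [Pi [G [PiF ->]]] := box_decomposition A'.
by exists Pi, G; rewrite boxes1D (msetDC [mset _]) msetDA.
Qed.

Lemma mem_box_part (Pi G : {mset formula}) (phi : formula) :
  box_free Pi -> (Box phi \in Pi `+` boxes G) = (phi \in G).
Proof.
move=> PiF; rewrite in_msetD mem_boxes.
by case: (boolP (Box phi \in Pi)) => // /PiF.
Qed.

(** * Identity and detachment in the calculus *)

Definition init (phi : formula) : Prop :=
  forall A, G4iSL (A `+` [mset phi]) (Some phi).

(** A form of modus ponens that avoids weakening: [A'] absorbs whatever the left rules leave over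
    when they decompose [phi]. *)
Definition detach (phi : formula) : Prop :=
  forall A psi Delta, (forall A', G4iSL (A `+` A' `+` [mset psi]) Delta) ->
    G4iSL (A `+` [mset phi] `+` [mset Imp phi psi]) Delta.

Lemma init_box (phi : formula) : init phi -> init (Box phi).
Proof.
move=> Iphi A.
have : Box phi \in A `+` [mset Box phi] by rewrite in_msetD mset11 orbT.
move=> /box_decomposition_mem[Pi [G [PiF ->]]]; apply: R4SL => //.
by rewrite /boxdot -!msetDA (msetDC [mset phi]) !msetDA; apply: Iphi.
Qed.

(** The two are proved together: identity for [Imp a b] detaches [a], while detaching an implication
    or a box closes the left premise by an identity. *)
Lemma init_detach (phi : formula) : init phi /\ detach phi.
Proof.
elim: phi => [|p|a [Ia Da] b [Ib Db]|a [Ia Da] b [Ib Db]|a [Ia Da] b [Ib Db]|a [Ia Da]].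
- split=> A; first exact: LBot.
  by move=> psi Delta _; rewrite msetDAC; apply: LBot.
- split=> A; first exact: At.
  move=> psi Delta H; apply: LAtomImp; apply: H.
- split=> A.
    by apply: LAnd; apply: RAnd; [rewrite msetDAC; apply: Ia|apply: Ib].
  move=> psi Delta H; apply: LAndImp; rewrite msetDAC; apply: LAnd.
  have -> : A `+` [mset Imp a (Imp b psi)] `+` [mset a] `+` [mset b] =
            A `+` [mset b] `+` [mset a] `+` [mset Imp a (Imp b psi)] by mset_ac.
  apply: Da => A'; rewrite (msetDAC A); apply: Db => A''.
  by rewrite -(msetDA A); apply: H.
- split=> A.
    by apply: LOr; [apply: ROr0|apply: ROr1].
  move=> psi Delta H; apply: LOrImp; rewrite -msetDA msetDAC; apply: LOr.
    rewrite (msetDC [mset _]) msetDA msetDAC.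
    by apply: Da => A'; rewrite -(msetDA A); apply: H.
  rewrite msetDA msetDAC.
  by apply: Db => A'; rewrite -(msetDA A); apply: H.
- have Iab : init (Imp a b).
    move=> A; apply: RImp; rewrite msetDAC.
    by apply: Da => A'; apply: Ib.
  split=> // A psi Delta H; apply: LImpImp; last by have := H [mset Imp a b].
  by rewrite msetDAC; apply: Iab.
- split; first exact: init_box.
  move=> A psi Delta H.
  (* Counting [Box a] in the boxed part puts [a] itself into the left premise of [ImpSL]. *)
  have : Box a \in A `+` [mset Box a] by rewrite in_msetD mset11 orbT.
  move=> /box_decomposition_mem[Pi [G [PiF E]]]; move: (H [mset Box a]).
  rewrite {}E => Hr; apply: ImpSL => //.
  have -> : Pi `+` boxdot ([mset a] `+` G) `+` [mset Box a] `+` [mset Imp (Box a) psi] =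
    Pi `+` G `+` boxes ([mset a] `+` G) `+` [mset Box a] `+` [mset Imp (Box a) psi]
    `+` [mset a] by rewrite /boxdot; mset_ac.
  exact: Ia.
Qed.

(** * Finite tree models *)

(* [Graft b c m] is [m] with one more child [c] below its root, along a modal
   edge when [b] is true and a purely intuitionistic edge otherwise. *)
Inductive model : Type :=
| World of seq nat
| Graft of bool & model & model.

Fixpoint atoms (m : model) : seq nat :=
  match m with World s => s | Graft _ _ m' => atoms m' end.

Fixpoint child (m : model) (b : bool) (c : model) : Prop :=
  match m with
  | World _ => False
  | Graft b' c' m' => b' = b /\ c' = c \/ child m' b c
  end.

Inductive le : model -> model -> Prop :=
| le_refl m : le m m
| le_child m b c w : child m b c -> le c w -> le m w.

Inductive below (m w : model) : Prop :=
| below_child c : child m true c -> le c w -> below m w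
| below_step b c : child m b c -> below c w -> below m w.

Lemma le_trans m1 m2 m3 : le m1 m2 -> le m2 m3 -> le m1 m3.
Proof. by elim=> // m b c w mc _ IH /IH; apply: le_child mc. Qed.

Lemma below_le m w : below m w -> le m w.
Proof. by elim=> {m w} m w => [c mc|b c mc _]; apply: le_child mc. Qed.

Lemma le_below m1 m2 m3 : le m1 m2 -> below m2 m3 -> below m1 m3.
Proof. by elim=> // m b c w mc _ IH /IH; apply: below_step mc. Qed.

Lemma below_le_trans m1 m2 m3 : below m1 m2 -> le m2 m3 -> below m1 m3.
Proof.
elim=> {m1 m2} m1 m2 => [c mc cm2 m23|b c mc _ IH /IH]; last exact: below_step mc.
by apply: below_child mc _; apply: le_trans m23.
Qed.

(** Converse well-foundedness of [below], by structural induction on the tree, strengthened to carry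
    [P] at all worlds reached through a child. *)
Lemma below_ind_model (P : model -> Prop) :
  (forall m, (forall w, below m w -> P w) -> P m) -> forall m, P m.
Proof.
move=> step; suff H m : P m /\ forall b c w, child m b c -> le c w -> P w.
  by move=> m; case: (H m).
have clos w c : P c -> (forall b d u, child c b d -> le d u -> P u) -> le c w -> P w.
  by move=> Pc Pd cw; case: cw Pc Pd => // m' b d v md dv _ /(_ _ _ _ md dv).
have top v : (forall b c w, child v b c -> le c w -> P w) -> P v.
  by move=> H; apply: step => w; case=> [c vc cw|b c vc /below_le cw]; apply: H vc cw.
elim: m => [s|b c [Pc Hc] m [_ Hm]].
  by split; first apply: top.
have H b' c' w : child (Graft b c m) b' c' -> le c' w -> P w.
  by move=> /= [[_ <-]|mc]; [apply: clos|apply: Hm mc].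
by split=> //; apply: top.
Qed.

(** * Forcing and soundness *)

(* Atoms need not be inherited by children: forcing an atom asks for it at all
   worlds above, which makes forcing persistent in every model. *)
Fixpoint force (phi : formula) (m : model) : Prop :=
  match phi with
  | Bot => False
  | Atom p => forall w, le m w -> p \in atoms w
  | And a b => force a m /\ force b m
  | Or a b => force a m \/ force b m
  | Imp a b => forall w, le m w -> force a w -> force b w
  | Box a => forall w, below m w -> force a w
  end.

Lemma force_le phi m w : le m w -> force phi m -> force phi w.
Proof.
elim: phi => [|p|a IHa b IHb|a IHa b IHb|a IHa b IHb|a IHa] //= mw.
- by move=> H v wv; apply: H; apply: le_trans wv.
- by move=> [/IHa-H /IHb-K]; split; [apply: H|apply: K].
- by move=> [/IHa-H|/IHb-K]; [left; apply: H|right; apply: K].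
- by move=> H v wv; apply: H; apply: le_trans wv.
- by move=> H v wv; apply: H; apply: le_below wv.
Qed.

Definition sat (A : {mset formula}) (m : model) : Prop :=
  forall phi, phi \in A -> force phi m.

Definition osat (Delta : option formula) (m : model) : Prop :=
  if Delta is Some phi then force phi m else False.

Lemma satD A B m : sat (A `+` B) m <-> sat A m /\ sat B m.
Proof.
split=> [H|[HA HB] phi]; last by rewrite in_msetD => /orP[/HA|/HB].
by split=> phi phiA; apply: H; rewrite in_msetD phiA ?orbT.
Qed.

Lemma sat1 phi m : sat [mset phi] m <-> force phi m.
Proof.
split=> [H|H psi]; first by apply: H; rewrite mset11.
by rewrite in_mset1 => /eqP->.
Qed.

Lemma sat_boxes A m : sat (boxes A) m <-> forall w, below m w -> sat A w.
Proof.
split=> [H w mw phi phiA|H phi].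
  by apply: (H (Box phi)) mw; rewrite mem_boxes.
by rewrite mem_boxes; case: phi => // phi phiA w mw; apply: H.
Qed.

Lemma sat_le A m w : le m w -> sat A m -> sat A w.
Proof. by move=> mw H phi /H; apply: force_le. Qed.

Definition satE := (satD, sat1).

(** Induction along [below] from the top of the tree: at each world, the worlds below it supply
    [Box phi], and [step] then gives [phi]. *)
Lemma loeb (A : {mset formula}) phi m :
  (forall w, sat A w -> force (Box phi) w -> force phi w) ->
  (forall w, below m w -> sat A w) -> force (Box phi) m.
Proof.
move=> step satA w; elim/below_ind_model: w => w IH mw.
apply: step; first exact: satA.
by move=> v wv; apply: (IH v wv); apply: below_le_trans mw (below_le wv).
Qed.

Lemma soundness A Delta m : G4iSL A Delta -> sat A m -> osat Delta m.
Proof.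
move=> D; elim: D m => {A Delta}.
- by move=> A p m; rewrite !satE => -[].
- by move=> A Delta m; rewrite !satE => -[].
- by move=> A a b _ IHa _ IHb m mA; split; [apply: IHa|apply: IHb].
- move=> A a b Delta _ IH m; rewrite !satE => -[mA [ma mb]].
  by apply: IH; rewrite !satE.
- by move=> A a b _ IH m mA; left; apply: IH.
- by move=> A a b _ IH m mA; right; apply: IH.
- move=> A a b Delta _ IHa _ IHb m; rewrite !satE => -[mA [ma|mb]].
    by apply: IHa; rewrite !satE.
  by apply: IHb; rewrite !satE.
- move=> A a b _ IH m mA w mw wa; apply: IH; rewrite !satE; split=> //.
  exact: sat_le mA.
- move=> A p a Delta _ IH m; rewrite !satE => -[[mA mp] mpa].
  by apply: IH; rewrite !satE; do !split=> //; apply: mpa mp; apply: le_refl.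
- move=> A a b c Delta _ IH m; rewrite !satE => -[mA mabc].
  apply: IH; rewrite !satE; split=> // w mw wa v wv vb.
  by apply: mabc (le_trans mw wv) _; split=> //; apply: force_le wa.
- move=> A a b c Delta _ IH m; rewrite !satE => -[mA mabc].
  apply: IH; rewrite !satE; do !split=> //.
    by move=> w mw wa; apply: mabc => //; left.
  by move=> w mw wb; apply: mabc => //; right.
- move=> A a b c Delta _ IHl _ IHr m; rewrite !satE => -[mA mabc].
  apply: IHr; rewrite !satE; split=> //; apply: (mabc m (le_refl m)).
  (* Since [b] entails [Imp a b], the principal formula entails [Imp b c]. *)
  apply: IHl; rewrite !satE; split=> // w mw wb; apply: mabc => // v wv va.
  exact: force_le wb.
- move=> Pi G a b Delta _ _ IHl _ IHr m; rewrite !satE => -[[mPi mG] mab].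
  apply: IHr; rewrite !satE; do !split=> //; apply: (mab m (le_refl m)).
  (* It remains to force [Box a] at [m]; the left premise is the step of the Löb induction. *)
  apply: (@loeb (Pi `+` boxdot G `+` [mset Imp (Box a) b])) => [w|w mw].
    by rewrite !satE => -[wA wab] wa; apply: IHl; rewrite !satE.
  have lemw := below_le mw; rewrite /boxdot !satE; do !split.
  - exact: sat_le mPi.
  - by move/sat_boxes: mG; apply.
  - exact: sat_le mG.
  - exact: force_le lemw mab.
- move=> Pi G a _ _ IH m; rewrite !satE => -[mPi mG].
  apply: (@loeb (Pi `+` boxdot G)) => [w wA wa|w mw].
    by apply: IH; rewrite satD sat1.
  have lemw := below_le mw; rewrite /boxdot !satE; do !split.
  - exact: sat_le mPi.
  - by move/sat_boxes: mG; apply.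
  - exact: sat_le mG.
Qed.

(** * Termination measures of proof search *)

(** The extra 1 for conjunction makes [Imp a (Imp b c)] lighter than [Imp (And a b) c]. *)
Fixpoint weight (phi : formula) : nat :=
  match phi with
  | Bot | Atom _ => 1
  | And a b => weight a + weight b + 2
  | Or a b | Imp a b => weight a + weight b + 1
  | Box a => weight a + 1
  end.

Definition msize (A : {mset formula}) : nat := \sum_(phi <- A) 4 ^ weight phi.

Definition osize (Delta : option formula) : nat :=
  if Delta is Some phi then 4 ^ weight phi else 0.

Lemma msizeD A B : msize (A `+` B) = msize A + msize B.
Proof. by rewrite /msize (perm_big _ (enum_msetD A B)) big_cat. Qed.

Lemma msize1 phi : msize [mset phi] = 4 ^ weight phi.
Proof. by rewrite /msize enum_msetn big_seq1. Qed.

Definition msizeE := (msizeD, msize1).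

Lemma osizeE phi : osize (Some phi) = 4 ^ weight phi.
Proof. by []. Qed.

Lemma expn4_lt m n : m < n -> 4 * 4 ^ m <= 4 ^ n.
Proof. by rewrite -expnS leq_exp2l. Qed.

Lemma expn4_gt0 n : 0 < 4 ^ n.
Proof. by rewrite expn_gt0. Qed.

(** [B] is a finite list holding the bodies of all boxed subformulas. It stays fixed during the
    search and bounds the boxes that can enter an antecedent. *)
Fixpoint boxes_in (B : seq formula) (phi : formula) : bool :=
  match phi with
  | Bot | Atom _ => true
  | And a b | Or a b | Imp a b => boxes_in B a && boxes_in B b
  | Box a => (a \in B) && boxes_in B a
  end.

Definition covers (B : seq formula) (A : {mset formula}) (Delta : option formula) :=
  all (boxes_in B) A && (if Delta is Some phi then boxes_in B phi else true).

Lemma all_msetD (P : pred formula) (A A' : {mset formula}) :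
  all P (A `+` A') = all P A && all P A'.
Proof. by rewrite (perm_all _ (enum_msetD A A')) all_cat. Qed.

Lemma all_mset1 (P : pred formula) phi : all P [mset phi] = P phi.
Proof. by rewrite enum_msetn /= andbT. Qed.

Lemma all_boxes (P : pred formula) (A : {mset formula}) :
  all P (boxes A) = all (fun phi => P (Box phi)) A.
Proof. by rewrite (perm_all _ (perm_eq_seq_mset _)) all_map. Qed.

Lemma boxes_in_sub B B' phi : {subset B <= B'} -> boxes_in B phi -> boxes_in B' phi.
Proof.
move=> sB; elim: phi => //= [a IHa b IHb|a IHa b IHb|a IHa b IHb|a IHa].
- by move=> /andP[/IHa-> /IHb->].
- by move=> /andP[/IHa-> /IHb->].
- by move=> /andP[/IHa-> /IHb->].
- by move=> /andP[/sB-> /IHa->].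
Qed.

Lemma ex_boxes_in phi : exists B, boxes_in B phi.
Proof.
have cat2 a b : (exists B, boxes_in B a) -> (exists B, boxes_in B b) ->
    exists B, boxes_in B a && boxes_in B b.
  move=> [B Ba] [B' Bb]; exists (B ++ B').
  by apply/andP; split; [apply: boxes_in_sub Ba|apply: boxes_in_sub Bb];
    move=> x xB; rewrite mem_cat xB ?orbT.
elim: phi => [|p|a IHa b IHb|a IHa b IHb|a IHa b IHb|a [B Ba]] //=; try exact: cat2.
- by exists [::].
- by exists [::].
- exists (a :: B); rewrite mem_head; apply: boxes_in_sub Ba => x xB.
  by rewrite inE xB orbT.
Qed.

Lemma ex_covers A Delta : exists B, covers B A Delta.
Proof.
have [B HB] : exists B, all (boxes_in B) A.
  elim: (enum_mset A) => [|phi s [B HB]]; first by exists [::].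
  have [B' HB'] := ex_boxes_in phi; exists (B' ++ B) => /=.
  apply/andP; split.
    by apply: boxes_in_sub HB' => x xB; rewrite mem_cat xB.
  by apply: sub_all HB => psi; apply: boxes_in_sub => x xB; rewrite mem_cat xB orbT.
case: Delta => [phi|]; last by exists B; rewrite /covers HB.
have [B' HB'] := ex_boxes_in phi; exists (B' ++ B).
apply/andP; split.
  by apply: sub_all HB => psi; apply: boxes_in_sub => x xB; rewrite mem_cat xB orbT.
by apply: boxes_in_sub HB' => x xB; rewrite mem_cat xB.
Qed.

Definition missing (B : seq formula) (A : {mset formula}) : nat :=
  count (fun phi => Box phi \notin A) B.

Definition box_sub (A A' : {mset formula}) : Prop :=
  forall phi, Box phi \in A -> Box phi \in A'.

Lemma missing_le B A A' : box_sub A A' -> missing B A' <= missing B A.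
Proof. by move=> sA; apply: sub_count => phi /=; apply: contra => /sA. Qed.

Lemma missing_lt B A A' phi : box_sub A A' -> phi \in B ->
  Box phi \notin A -> Box phi \in A' -> missing B A' < missing B A.
Proof.
move=> sA + phiA phiA'; elim: B => //= b B IH.
rewrite inE => /orP[/eqP<-|/IH lt]; first by rewrite phiA phiA'; apply: missing_le.
rewrite -addnS; apply: leq_add lt; case: (boolP (Box b \in A)) => [/sA->|_] //.
exact: leq_b1.
Qed.

(** * Countermodels of irreducible sequents *)

Definition decided A Delta : Prop :=
  G4iSL A Delta \/ exists2 m, sat A m & ~ osat Delta m.

(** Finiteness of [s] replaces excluded middle here. *)
Lemma all_or (T : eqType) (s : seq T) (X : Prop) (P : T -> Prop) :
  (forall x, x \in s -> X \/ P x) -> X \/ forall x, x \in s -> P x.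
Proof.
elim: s => [|x s IH] H; first by right.
have [|Px] := H x (mem_head x s); first by left.
have [y ys||Ps] := IH; first by apply: H; rewrite inE ys orbT.
  by left.
by right=> y; rewrite inE => /orP[/eqP->|/Ps].
Qed.

Definition good_child (A : {mset formula}) (b : bool) (c : model) : Prop :=
  sat A c /\ (b -> forall phi, Box phi \in A -> force phi c).

(** Both alternatives quantify over all suitable roots, so a refutation survives when further
    children are grafted. This lets one root refute several formulas at once. *)
Definition refutable (A : {mset formula}) (phi : formula) : Prop :=
  (forall m, (forall p, p \in atoms m -> Atom p \in A) -> ~ force phi m) \/
  exists b c, good_child A b c /\ forall m, child m b c -> ~ force phi m.

Lemma refute_all (A : {mset formula}) (s : seq formula) : (forall phi, phi \in s -> refutable A phi) ->
  exists m, [/\ forall p, (p \in atoms m) = (Atom p \in A),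
    forall b c, child m b c -> good_child A b c &
    forall phi, phi \in s -> ~ force phi m].
Proof.
pose at_list := pmap (fun phi => if phi is Atom p then Some p else None) A.
have mem_at p : (p \in at_list) = (Atom p \in A).
  rewrite mem_pmap; apply/mapP/idP => [[[] // q qA [->]] //|pA].
  by exists (Atom p).
(* The induction carries the reason for each failure, since failure at the current root says nothing
   by itself about the root after a graft. *)
suff H : (forall phi, phi \in s -> refutable A phi) ->
    exists m, [/\ atoms m = at_list, forall b c, child m b c -> good_child A b c &
    forall phi, phi \in s ->
      (forall m, (forall p, p \in atoms m -> Atom p \in A) -> ~ force phi m) \/
      exists b c, child m b c /\ forall m', child m' b c -> ~ force phi m'].
  move=> /H[m [atm mc ms]]; exists m; split=> // [p|phi /ms[|]].
  - by rewrite atm.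
  - by apply=> p; rewrite atm mem_at.
  - by move=> [b [c [mbc]]]; apply.
elim: s => [|phi s IH] H; first by exists (World at_list).
have [psi psis|m [atm mc ms]] := IH; first by apply: H; rewrite inE psis orbT.
have [Hphi|[b [c [gbc Hbc]]]] := H phi (mem_head _ _).
  by exists m; split=> // psi; rewrite inE => /orP[/eqP->|/ms]; [left|].
exists (Graft b c m); split=> //= [b' c' [[<- <-] //|/mc] //|psi].
rewrite inE => /orP[/eqP->|/ms[|[b' [c' [mbc Hc]]]]]; last 2 first.
- by left.
- by right; exists b', c'; split=> //; right.
by right; exists b, c; split=> //; left.
Qed.

(** These formulas hold at a root whose atoms are those of [A] and whose children are good, once the
    antecedents of implications fail there. *)
Definition settled (A : {mset formula}) (phi : formula) : Prop :=
  match phi with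
  | Atom _ | Box _ => True
  | Imp a _ => refutable A a
  | _ => False
  end.

(** The right rules for disjunction are not invertible, so both disjuncts have to fail at the same
    root. *)
Definition disjuncts (Delta : option formula) : seq formula :=
  match Delta with
  | None => [::]
  | Some (Or a b) => [:: a; b]
  | Some a => [:: a]
  end.

Lemma settled_countermodel (A : {mset formula}) Delta :
  (forall phi, phi \in A -> settled A phi) -> (forall phi, phi \in disjuncts Delta -> refutable A phi) ->
  exists2 m, sat A m & ~ osat Delta m.
Proof.
move=> setA setD.
pose ant := pmap (fun phi => if phi is Imp a _ then Some a else None) A.
have [phi|m [atm mc ms]] := @refute_all A (ant ++ disjuncts Delta).
  rewrite mem_cat => /orP[|/setD//].
  by rewrite mem_pmap => /mapP[[] // a b /setA H [->]].
(* All worlds above the root force [A] by persistence from a good child, so only the root itself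
   needs checking. *)
have le_sat w : le m w -> w = m \/ sat A w.
  move=> mw; case: mw mc => [|m' b c v m'c cv] mc; first by left.
  by right; apply: sat_le cv _; case: (mc _ _ m'c).
have sat_below w phi : below m w -> Box phi \in A -> force phi w.
  case=> [c /mc[_ Hc] cw /Hc|b c /mc[cA _] cw /cA]; first by move=> /(_ isT); apply: force_le.
  exact.
exists m => [phi phiA|].
  have := setA _ phiA; case: phi phiA => // [p pA _|a b abA _|a aA _] w mw.
  - by case: (le_sat _ mw) => [->|/(_ _ pA)/(_ _ (le_refl _))//]; rewrite atm.
  - case: (le_sat _ mw) => [->|/(_ _ abA)/(_ _ (le_refl _))//] ma; case: (ms a) => //.
    by rewrite mem_cat mem_pmap; apply/orP; left; apply/mapP; exists (Imp a b).
  - exact: sat_below mw aA.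
have {}ms a : a \in disjuncts Delta -> ~ force a m.
  by move=> aD; apply: ms; rewrite mem_cat aD orbT.
case: Delta {setD} ms => [[|p|a b|a b|a b|a]|] ms;
  try by apply: ms; rewrite mem_head.
- by case; apply: ms; rewrite !inE eqxx ?orbT.
- by [].
Qed.

(** * One step of backward proof search *)

Lemma init_mem (A : {mset formula}) phi : phi \in A -> G4iSL A (Some phi).
Proof. by move=> /mset_split[A' ->]; case: (init_detach phi) => + _; apply. Qed.

Lemma boxes_in_unbox B (A : {mset formula}) :
  all (boxes_in B) (boxes A) -> all (boxes_in B) A.
Proof. by rewrite all_boxes; apply: sub_all => phi /andP[]. Qed.

Lemma box_sub_add A phi A' : ~~ is_boxed phi -> box_sub (A `+` [mset phi]) (A `+` A').
Proof.
move=> nphi psi; rewrite !in_msetD in_mset1 => /orP[->//|/eqP E].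
by rewrite -E in nphi.
Qed.

Lemma box_sub_l A A' : box_sub A (A `+` A').
Proof. by move=> phi; rewrite in_msetD => ->. Qed.

(* Every formula of the premise other than the context is lighter than the
   principal formula [phi], and there are at most three of them. *)
Ltac size_lt phi :=
  rewrite ?msizeE ?osizeE;
  repeat match goal with |- context [4 ^ weight ?x] =>
    tryif constr_eq x phi then fail else
    (let H := fresh in
     assert (H : 4 * 4 ^ weight x <= 4 ^ weight phi)
       by (apply: expn4_lt; rewrite /=; lia);
     revert H; generalize (4 ^ weight x); intro)
  end;
  move: (expn4_gt0 (weight phi)); generalize (4 ^ weight phi); lia.

Ltac covers_tac :=
  match goal with H : is_true (covers _ _ _) |- _ => move: H end;
  rewrite /covers ?all_msetD ?all_mset1 /=; lia.

Section Search.

Context (B : seq formula) (A : {mset formula}) (Delta : option formula).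
Context (IHsize : forall A' Delta', box_sub A A' ->
  msize A' + osize Delta' < msize A + osize Delta -> covers B A' Delta' ->
  decided A' Delta').
Context (IHbox : forall A' Delta', missing B A' < missing B A ->
  covers B A' Delta' -> decided A' Delta').
Context (covA : covers B A Delta).

(** An applicable invertible left rule decides the whole sequent. An implication may remain when its
    antecedent is refutable at the root. *)
Lemma search_antecedent phi : phi \in A -> decided A Delta \/ settled A phi.
Proof.
move=> phiA; have [A' eA] := mset_split phiA.
have sub A'' : ~~ is_boxed phi -> box_sub A (A' `+` A'').
  by move=> nphi; rewrite eA; apply: box_sub_add.
case: phi phiA eA sub => [|p|a b|a b|a d|a] phiA eA sub.
- by left; left; rewrite eA; apply: LBot.
- by right.
- left; have [|||D|[m mA mD]] := @IHsize (A' `+` ([mset a] `+` [mset b])) Delta.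
  + exact: sub.
  + rewrite eA; size_lt (And a b).
  + by move: covA; rewrite eA => cov; covers_tac.
  + by left; rewrite eA; apply: LAnd; rewrite -msetDA.
  + by right; exists m => //; rewrite eA; move: mA; rewrite !satE.
- left; have [|||Da|[m mA mD]] := @IHsize (A' `+` [mset a]) Delta.
  + exact: sub.
  + rewrite eA; size_lt (Or a b).
  + by move: covA; rewrite eA => cov; covers_tac.
  + have [|||Db|[m mA mD]] := @IHsize (A' `+` [mset b]) Delta.
    * exact: sub.
    * rewrite eA; size_lt (Or a b).
    * by move: covA; rewrite eA => cov; covers_tac.
    * by left; rewrite eA; apply: LOr.
    * right; exists m => //; rewrite eA; move: mA; rewrite !satE => -[? ?].
      by split=> //; right.
  + right; exists m => //; rewrite eA; move: mA; rewrite !satE => -[? ?].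
    by split=> //; left.
- case: a phiA eA sub => [|p|a b|a b|a b|a] phiA eA sub.
  + by right; left=> m _ [].
  + have [pA|pA] := boolP (Atom p \in A); last first.
      by right; left=> m /(_ p) H /(_ m (le_refl m)) /H pA'; rewrite pA' in pA.
    left; have [A'' eA'] : exists A'', A' = A'' `+` [mset Atom p].
      apply: mset_split; move: pA; rewrite eA in_msetD => /orP[//|].
      by rewrite in_mset1.
    have [|||D|[m mA mD]] := @IHsize (A' `+` [mset d]) Delta.
    * exact: sub.
    * rewrite eA; size_lt (Imp (Atom p) d).
    * by move: covA; rewrite eA => cov; covers_tac.
    * by left; rewrite eA eA'; apply: LAtomImp; rewrite -eA'.
    * right; exists m => //; rewrite eA; move: mA; rewrite !satE => -[mA' md].
      by split=> // w mw _; apply: force_le mw md.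
  + left; have [|||D|[m mA mD]] := @IHsize (A' `+` [mset Imp a (Imp b d)]) Delta.
    * exact: sub.
    * rewrite eA; size_lt (Imp (And a b) d).
    * by move: covA; rewrite eA => cov; covers_tac.
    * by left; rewrite eA; apply: LAndImp.
    * right; exists m => //; rewrite eA; move: mA; rewrite !satE => -[mA' mabd].
      split=> // w mw [wa wb]; exact: (mabd _ mw wa _ (le_refl w) wb).
  + left; have [|||D|[m mA mD]] := @IHsize (A' `+` ([mset Imp a d] `+` [mset Imp b d])) Delta.
    * exact: sub.
    * rewrite eA; size_lt (Imp (Or a b) d).
    * by move: covA; rewrite eA => cov; covers_tac.
    * by left; rewrite eA; apply: LOrImp; rewrite -msetDA.
    * right; exists m => //; rewrite eA; move: mA; rewrite !satE => -[mA' [mad mbd]].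
      by split=> // w mw [wa|wb]; [apply: mad|apply: mbd].
  (* The right premise comes first: its countermodels refute the conclusion, because [d] entails the
     principal formula. Only if it is derivable does the left premise matter. *)
  + have [|||Dr|[m mA mD]] := @IHsize (A' `+` [mset d]) Delta.
    * exact: sub.
    * rewrite eA; size_lt (Imp (Imp a b) d).
    * by move: covA; rewrite eA => cov; covers_tac.
    (* Searching with [a] in the antecedent instead of [Imp a b] in the
       succedent makes the countermodel [c] force [a], and there
       [Imp b d] entails [Imp (Imp a b) d]. *)
    * have [|||Dl|[c cA cb]] := @IHsize (A' `+` ([mset Imp b d] `+` [mset a])) (Some b).
      - exact: sub.
      - rewrite eA; size_lt (Imp (Imp a b) d).
      - by move: covA; rewrite eA => cov; covers_tac.
      - by left; left; rewrite eA; apply: LImpImp => //; apply: RImp; rewrite -msetDA.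
      - right; right; exists false, c; move: cA; rewrite !satE => -[cA' [cbd ca]].
        split; last first.
          move=> m mc /(_ c (le_child mc (le_refl c)) ca); exact: cb.
        split=> //; rewrite eA !satE; split=> // w cw wab.
        by apply: (cbd w cw); apply: (wab w (le_refl w)); apply: force_le ca.
    * left; right; exists m => //; rewrite eA; move: mA; rewrite !satE => -[mA' md].
      by split=> // w mw _; apply: force_le mw md.
  + have [|||Dr|[m mA mD]] := @IHsize (A' `+` [mset d]) Delta.
    * exact: sub.
    * rewrite eA; size_lt (Imp (Box a) d).
    * by move: covA; rewrite eA => cov; covers_tac.
    * have [Pi [G [PiF eA']]] := box_decomposition A'.
      have memG psi : (Box psi \in A) = (psi \in G).
        by rewrite -(mem_box_part G psi PiF) -eA' eA in_msetD in_mset1 orbF.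
      have rule : G4iSL (Pi `+` boxdot G `+` [mset Box a] `+` [mset Imp (Box a) d]) (Some a) ->
          G4iSL A Delta.
        by move=> Dl; rewrite eA eA'; apply: ImpSL => //; rewrite -eA'.
      have [aG|aG] := boolP (a \in G).
        by left; left; apply/rule/init_mem; rewrite /boxdot !in_msetD aG !orbT.
      have [||Dl|[c cA ca]] :=
          @IHbox (Pi `+` boxdot G `+` [mset Box a] `+` [mset Imp (Box a) d]) (Some a).
      - apply: (@missing_lt _ _ _ a).
        + by move=> psi; rewrite memG !in_msetD mem_boxes => ->; rewrite !orbT.
        + by move: covA; rewrite eA /covers all_msetD all_mset1 /=; lia.
        + by rewrite memG.
        + by rewrite !in_msetD mset11 !orbT.
      - have : covers B (Pi `+` boxes G `+` [mset Imp (Box a) d]) Delta by rewrite -eA' -eA.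
        move: (@boxes_in_unbox B G); rewrite /covers !all_msetD !all_mset1 /=; lia.
      - by left; left; apply: rule.
      (* As a modal child, [c] refutes [Box a] at the root because [a] fails at [c]; it is good
         because it forces [G] as well as [boxes G]. *)
      - right; right; exists true, c; move: cA; rewrite /boxdot !satE.
        move=> [[[cPi [cG cbG]] cba] cad]; split; last first.
          by move=> m mc /(_ c (below_child mc (le_refl c))).
        split; last by move=> _ psi; rewrite memG => /cG.
        by rewrite eA eA' !satE.
    * left; right; exists m => //; rewrite eA; move: mA; rewrite !satE => -[mA' md].
      by split=> // w mw _; apply: force_le mw md.
- by right.
Qed.

Lemma search_succedent :
  decided A Delta \/ forall phi, phi \in disjuncts Delta -> refutable A phi.
Proof.
case: Delta IHsize IHbox covA => [phi|] IHs IHb cov; last by right.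
case: phi IHs IHb cov => [|p|a b|a b|a b|a] IHs IHb cov.
- by right=> phi; rewrite inE => /eqP->; left=> m _ [].
- have [pA|pA] := boolP (Atom p \in A); first by left; left; apply: init_mem.
  right=> phi; rewrite inE => /eqP->; left=> m /(_ p) H /(_ m (le_refl m)) /H pA'.
  by rewrite pA' in pA.
- left; have [|||Da|[m mA mD]] := IHs A (Some a).
  + by [].
  + size_lt (And a b).
  + covers_tac.
  + have [|||Db|[m mA mD]] := IHs A (Some b).
    * by [].
    * size_lt (And a b).
    * covers_tac.
    * by left; apply: RAnd.
    * by right; exists m => // -[].
  + by right; exists m => // -[].
- have [|||Da|[m mA mD]] := IHs A (Some a).
  + by [].
  + size_lt (Or a b).
  + covers_tac.
  + by left; left; apply: ROr0.
  + have [|||Db|[m' mA' mD']] := IHs A (Some b).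
    * by [].
    * size_lt (Or a b).
    * covers_tac.
    * by left; left; apply: ROr1.
    (* By persistence, an intuitionistic child at which [phi] fails makes [phi] fail at the root. *)
    * have ref phi c : sat A c -> ~ force phi c -> refutable A phi.
        move=> cA Hc; right; exists false, c; split=> // v vc Hv; apply: Hc.
        by apply: force_le Hv; apply: le_child vc (le_refl c).
      right=> phi; rewrite !inE => /orP[]/eqP->; first exact: ref mA mD.
      exact: ref mA' mD'.
- left; have [|||D|[m mA mD]] := IHs (A `+` [mset a]) (Some b).
  + exact: box_sub_l.
  + size_lt (Imp a b).
  + covers_tac.
  + by left; apply: RImp.
  + move: mA; rewrite !satE => -[mA ma].
    by right; exists m => // /(_ m (le_refl m) ma).
- have [aA|aA] := boolP (Box a \in A); first by left; left; apply: init_mem.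
  have [Pi [G [PiF eA]]] := box_decomposition A.
  have memG psi : (Box psi \in A) = (psi \in G) by rewrite eA mem_box_part.
  have [||D|[c cA ca]] := IHb (Pi `+` boxdot G `+` [mset Box a]) (Some a).
  + apply: (@missing_lt _ _ _ a) => //.
    * by move=> psi; rewrite memG !in_msetD mem_boxes => ->; rewrite !orbT.
    * by move: cov; rewrite /covers /=; lia.
    * by rewrite !in_msetD mset11 !orbT.
  + move: (@boxes_in_unbox B G) cov; rewrite {1}eA.
    by rewrite /covers !all_msetD !all_mset1 /=; lia.
  + by left; left; rewrite eA; apply: R4SL.
  + move: cA; rewrite /boxdot !satE => -[[cPi [cG cbG]] cba].
    right=> phi; rewrite inE => /eqP->; right; exists true, c; split.
      split; last by move=> _ psi; rewrite memG => /cG.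
      by rewrite eA !satE.
    by move=> m mc /(_ c (below_child mc (le_refl c))).
Qed.

Lemma search : decided A Delta.
Proof.
have [//|setA] := all_or search_antecedent.
have [//|setD] := search_succedent.
by right; apply: settled_countermodel.
Qed.

End Search.

(** * Completeness and admissibility *)

(** Lexicographic induction, first on the number of missing boxes and then on the size, with the
    list [B] fixed by the initial sequent. *)
Lemma completeness A Delta : decided A Delta.
Proof.
have [B] := ex_covers A Delta.
suff H k n A' Delta' : missing B A' < k -> msize A' + osize Delta' < n ->
    covers B A' Delta' -> decided A' Delta' by apply: H.
elim: k n A' Delta' => // k IHk; elim=> // n IHn A' Delta' ltk ltn cov.
apply: (search _ _ cov) => A'' Delta'' H.
  move=> lt; apply: IHn; last exact: leq_trans lt ltn.
  exact: leq_ltn_trans (missing_le B H) ltk.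
by apply: IHk; [apply: leq_trans H ltk|apply: leqnn].
Qed.

Lemma derivable_valid A Delta :
  G4iSL A Delta <-> forall m, sat A m -> osat Delta m.
Proof.
split=> [D m|valid]; first exact: soundness.
by case: (completeness A Delta) => // -[m /valid].
Qed.

Theorem corollary1 :
  (forall (Gamma1 Gamma2 : {mset formula}) (phi : formula)
          (Delta : option formula),
      G4iSL Gamma1 (Some phi) ->
      G4iSL ([mset phi] `+` Gamma2) Delta ->
      G4iSL (Gamma1 `+` Gamma2) Delta)
  /\
  (forall (Gamma : {mset formula}) (phi : formula) (Delta : option formula),
      G4iSL (Gamma `+` [mset phi] `+` [mset phi]) Delta ->
      G4iSL (Gamma `+` [mset phi]) Delta).
Proof.
split=> [G1 G2 phi Delta D1 D2|G phi Delta D]; apply/derivable_valid => m.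
  move=> /satD[mG1 mG2]; apply: (soundness D2).
  by rewrite !satE; split=> //; apply: (soundness D1).
by move=> mG; apply: (soundness D); rewrite satD; split=> //; case/satD: mG.
Qed.
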